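(* There exists a universal constant $c>0$ (not depending on $\Delta$) such that the following holds. Fix an integer $\Delta\ge 3$. For every large $n$ with $\Delta n$ even, let $G_n$ be a uniform random $\Delta$-regular graph on $n$ vertices. Then with probability $1-o(1)$ as $n\to\infty$, $G_n$ has the following property: for every integer $1\le d\le c\log n$ and for every $d$-dimensional normed space $X$, there is no geometric embedding of $G_n$ into $X$.
   Context: Normed spaces are real. Graphs are simple and undirected; ''uniform random $\Delta$-regular graph'' means uniformly distributed on the set of simple $\Delta$-regular graphs with vertex set $\{1,\dots,n\}$. $\log$ is the natural logarithm. Given a normed space $(X,\|\cdot\|_X)$ and a set $V$ of $n$ distinct points of $X$, the geometric (distance) graph in $X$ on $V$ is the graph with vertex set $V$ in which two distinct points $v,w\in V$ are adjacent if and only if $\|v-w\|_X\le 1$. A graph $G$ on $n$ vertices admits a geometric embedding into $X$ if some geometric graph in $X$ (on $n$ distinct points) is isomorphic to $G$. *)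

(* Defs.v *)
From HB Require Import structures.
From mathcomp Require Import all_boot all_order all_algebra finmap.
From mathcomp Require Import all_classical all_reals all_analysis.

Set Implicit Arguments.
Unset Strict Implicit.
Unset Printing Implicit Defensive.

Import Order.TTheory GRing.Theory Num.Theory.
Import numFieldNormedType.Exports.

Local Open Scope ring_scope.

(* The dimension of such a space X is \dim {:X}. *)
#[short(type="normedVectType")]
HB.structure Definition NormedVector (K : numFieldType) :=
  {T of NormedModule K T & Vector K T}.

Record simple_graph (T : finType) := SimpleGraph {
  edges : {set {set T}};
  edges_card2 : [forall e in edges, #|e| == 2]
}.

HB.instance Definition _ (T : finType) := [isSub for @edges T].
HB.instance Definition _ (T : finType) := [Finite of simple_graph T by <:].

(* Irreflexive, since [set x; x] has cardinal 1. *)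
Definition adj (T : finType) (G : simple_graph T) : rel T :=
  fun x y => [set x; y]%SET \in edges G.

Definition isomorphic (T U : finType) (G : simple_graph T)
    (H : simple_graph U) : Prop :=
  exists f : T -> U, bijective f /\ forall x y, adj G x y = adj H (f x) (f y).

Definition regular_graphs (n D : nat) : {set simple_graph 'I_n} :=
  [set G : simple_graph 'I_n |
    [forall v, #|[set w | adj G v w]%SET| == D]]%SET.

(* Probability of the event P for a uniform random element of A; this is the
   junk value 0 when A is empty. *)
Definition uniform_pr (R : realType) (T : finType) (A : {set T})
    (P : T -> Prop) : R :=
  #|[set x in A | `[< P x >]]%SET|%:R / #|A|%:R.

Section GeometricGraph.
Variables (R : realType) (X : normedModType R) (V : {fset X}).

Definition geometric_edges : {set {set V}} :=
  [set [set p.1; p.2]%SET | p : V * V &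
    (p.1 != p.2) && (`|\val p.1 - \val p.2| <= 1)]%SET.

Lemma geometric_edges_card2 : [forall e in geometric_edges, #|e| == 2].
Proof.
apply/forall_inP => e /imsetP[[v w]]; rewrite inE /= => /andP[vw _] ->.
by rewrite cards2 vw.
Qed.

Definition geometric_graph : simple_graph V :=
  SimpleGraph geometric_edges_card2.

Lemma adj_geometric_graph (v w : V) :
  adj geometric_graph v w = (v != w) && (`|\val v - \val w| <= 1).
Proof.
apply/imsetP/idP => [[[a b]]|vw]; last by exists (v, w); rewrite ?inE.
rewrite inE /= => /andP[ab ab1] e.
have vw : v != w.
  by have /(congr1 (fun s : {set V} => #|s|)) := e; rewrite !cards2 ab; case: eqP.
rewrite vw /=.
have : v \in [set a; b]%SET by rewrite -e set21.
have : w \in [set a; b]%SET by rewrite -e set22.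
rewrite !inE => /orP[]/eqP wE /orP[]/eqP vE; move: vw ab1;
  by rewrite vE wE ?eqxx // distrC.
Qed.

End GeometricGraph.

(* A finite set V carrying a geometric graph isomorphic to G automatically
   consists of #|T| distinct points. *)
Definition geometrically_embeds (R : realType) (X : normedModType R)
    (T : finType) (G : simple_graph T) : Prop :=
  exists V : {fset X}, isomorphic G (geometric_graph V).

(* Main.v *)
Require Import Defs.
From HB Require Import structures.
From mathcomp Require Import all_boot all_order all_algebra finmap.
From mathcomp Require Import fingroup perm.
From mathcomp Require Import all_classical all_reals all_analysis.
From mathcomp Require Import zify ring lra.

(** The proof is a count. There are about n ^ (D n / 2) labelled D-regular
    graphs on n vertices, and it is shown that far fewer of them embed
    geometrically into some normed space of dimension at most c log n.

    A finite-dimensional normed space X, of dimension d, carries a lattice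
    whose nonzero vectors have norm at least 1 and such that every point of X
    is within distance 3 of the lattice ([halvable_lattice],
    [halvable_cover]). If the vectors in some set of lattice points are
    pairwise at distance less than 24, they are distinct modulo 24, so there
    are at most 24 ^ d of them ([separated_packing]). Rescaling by 6 and
    rounding the vertices of an embedded graph to the lattice gives integer
    vectors such that vertices rounded to the same vector are adjacent, and
    such that the differences along edges take at most 24 ^ d values
    ([lattice_rounding]). Call these values the steps, and let M bound their
    number; when d <= c log n, M is at most a small power of n.

    Up to translation in each connected component, the rounded positions are
    recovered from a spanning forest with a step attached to every vertex:
    n ^ n * M ^ n possibilities. Neither the space nor the lattice has to be
    recorded. Two formal sums of steps along paths of the forest end at the
    same lattice point exactly when their difference lies in the kernel of the
    linear map sending each formal step to its value; only integer vectors
    with entries of absolute value at most n + 1 matter, so the kernel can be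
    replaced by the span of at most M such vectors ([kernel_box_basis]):
    (2 n + 3) ^ (M ^ 2) possibilities, which is negligible. Finally each of
    the D neighbours of a vertex is named by a step and by its rank among the
    at most D + 1 vertices rounded to the point so reached:
    (M (D + 1)) ^ (n D) possibilities. Hence [regular_graph_is_decoded], and
    the embeddable graphs number n ^ (n + o(n)) times a power of n whose
    exponent is a small multiple of D n.

    Since D / 2 > 1 when D >= 3, it remains to exhibit n ^ (D n / 2 - o(n))
    regular graphs. The q-fold lifts of the complete bipartite graph K_{D,D}
    are determined by D ^ 2 arbitrary permutations of q points, and a
    circulant graph takes care of the few vertices left over when n is not a
    multiple of 2 D ([regular_graphs_lower_bound]). The two counts are
    compared in [code_bound_lt_graphs]. *)

Import Order.TTheory GRing.Theory Num.Theory.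
Import numFieldNormedType.Exports.

Local Open Scope classical_set_scope.
Local Open Scope ring_scope.

(** * Lattices with controlled packing and covering radius *)

Lemma odd_int_sub (k : int) : odd (absz k) -> k - 2 * divz k 2 = 1.
Proof. lia. Qed.

Lemma sub_floor_itv {R : realType} (x : R) : 0 <= x - (Num.floor x)%:~R < 1.
Proof.
by have := floorD1_gt x; have := floor_le_tmp x; rewrite intrD; lra.
Qed.

Section Lattice.
Context {R : realType} {d : nat}.
Variable N : 'rV[R]_d -> R.
Hypothesis N_add : forall u v, N (u + v) <= N u + N v.
Hypothesis N_scale : forall a u, N (a *: u) = `|a| * N u.
Hypothesis N_eq0 : forall u, N u = 0 -> u = 0.

Local Notation iv := (map_mx (intr : int -> R)).

Let N0 : N 0 = 0. Proof. by rewrite -(scale0r 0) N_scale normr0 mul0r. Qed.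
Let N_opp u : N (- u) = N u.
Proof. by rewrite -scaleN1r N_scale normrN normr1 mul1r. Qed.
Let N_ge0 u : 0 <= N u.
Proof. by have := N_add u (- u); rewrite subrr N0 N_opp; lra. Qed.
Let N_sub u v w : N (u - w) <= N (u - v) + N (v - w).
Proof. by have -> : u - w = (u - v) + (v - w) by rewrite addrA subrK. Qed.

Lemma norm_mulmx_le (u : 'rV[R]_d) (B : 'M[R]_d) :
  N (u *m B) <= \sum_j `|u 0 j| * N (row j B).
Proof.
rewrite mulmx_sum_row; elim/big_ind2 : _ => [|x x' y y' xx yy|i _].
- by rewrite N0.
- by apply: le_trans (N_add _ _) _; exact: lerD.
- by rewrite N_scale.
Qed.

(** The unit sphere for the sup norm is compact, so N has a positive minimum on
    it. This is the only use of compactness: it provides a first lattice whose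
    nonzero vectors are not short. *)
Lemma coordinates_le_norm : exists2 c : R, 0 < c & forall u, c * `|u| <= N u.
Proof.
pose C := \sum_j N (row j 1%:M) + 1.
have C0 : 0 < C by rewrite ltr_wpDl // sumr_ge0.
have NC u : N u <= C * `|u|.
  rewrite -{1}[u]mulmx1; apply: le_trans (norm_mulmx_le _ _) _.
  rewrite mulrDl mul1r mulr_suml; apply: ler_wpDr => //.
  apply: ler_sum => j _; rewrite mulrC ler_wpM2l //.
  rewrite [X in _ <= X]/Num.norm /= mx_normrE.
  by apply: (le_bigmax _ (fun ij => `|u ij.1 ij.2|) (0, j)).
have Nlip u v : `|N u - N v| <= C * `|u - v|.
  rewrite ler_norml; apply/andP; split.
    have := N_add (v - u) u; rewrite subrK => h.
    by have := NC (v - u); rewrite distrC; lra.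
  have := N_add (u - v) v; rewrite subrK => h.
  by have := NC (u - v); lra.
have Ncont : continuous (N : 'rV[R]_d -> R).
  move=> u; apply/(@cvgrPdist_lt _ _ _ (nbhs u)) => e e0; apply/(@nbhs_normP R 'rV[R]_d u).
  exists (e / C); first exact: divr_gt0.
  move=> v /= uv; apply: le_lt_trans (Nlip _ _) _.
  by rewrite mulrC -ltr_pdivlMr.
pose A := [set u : 'rV[R]_d | `|u| = 1].
have [A0|/set0P/negP/negPn/eqP A0] := pselect (A !=set0); last first.
  exists 1 => // u; rewrite mul1r; have [->|u0] := eqVneq u 0.
    by rewrite normr0.
  suff : A (`|u|^-1 *: u) by rewrite A0.
  by rewrite /A /= normrZ normfV normr_id mulVf // normr_eq0.
have cA : compact A.
  apply: bounded_closed_compact.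
    by exists 1; split => // x x1 u /= ->; exact: ltW.
  have /continuous_closedP := @norm_continuous R 'rV[R]_d.
  by move=> /(_ _ (@closed_eq R 1)).
have [|m] := @EVT_min_rV R d N A A0 cA.
  exact: continuous_subspaceT.
rewrite inE => m1 mmin; rewrite /A /= in m1.
have m0 : 0 < N m.
  rewrite lt_def N_ge0 andbT; apply/eqP => /N_eq0 mE.
  by move: m1; rewrite mE normr0 => /esym/eqP; rewrite oner_eq0.
exists (N m) => // u; have [->|u0] := eqVneq u 0; first by rewrite normr0 mulr0.
have u0' : 0 < `|u| by rewrite normr_gt0.
have := mmin (`|u|^-1 *: u); rewrite inE /A /= normrZ normfV normr_id.
rewrite mulVf ?gt_eqF // N_scale normfV normr_id => /(_ erefl).
by rewrite ler_pdivlMl // mulrC.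
Qed.


Definition separated (B : 'M[R]_d) :=
  forall z : 'rV[int]_d, z != 0 -> 1 <= N (iv z *m B).

(** A weak form of the covering property: the half of every lattice vector is
    close to the lattice. It is what maximality among separated lattices
    yields, and it implies genuine covering by iterated halving. *)
Definition halvable (B : 'M[R]_d) :=
  forall z : 'rV[int]_d, exists w : 'rV[int]_d,
    N (2^-1 *: (iv z *m B) - iv w *m B) < 1.

Lemma separated_scalar : exists2 B, B \in unitmx & separated B.
Proof.
have [c c0 cN] := coordinates_le_norm.
exists (c^-1)%:M.
  by rewrite unitmxE det_scalar unitfE expf_neq0 // invr_eq0 gt_eqF.
move=> z z0; rewrite mul_mx_scalar N_scale ger0_norm; last by rewrite invr_ge0 ltW.
rewrite mulrC ler_pdivlMr // mul1r; apply: le_trans (cN _).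
rewrite ler_pMr //.
have [j zj] : exists j, z 0 j != 0.
  by apply/rV0Pn.
rewrite [X in _ <= X]/Num.norm /= mx_normrE.
apply: le_trans (le_bigmax _ (fun ij => `|iv z ij.1 ij.2|) (0, j)).
by rewrite /= mxE -intr_norm ler1z; lia.
Qed.

(** If y is half of a lattice vector and is at distance at least 1 from the
    lattice L, then the union of L and y + L is again a separated lattice.
    Some coordinate z_i of 2 y is odd, and may be assumed to be 1 after a
    translation of y by a lattice vector; then replacing the i-th basis vector
    by y gives a basis of the larger lattice, because that basis vector is
    2 y minus a combination of the others. *)
Lemma refine_lattice B : B \in unitmx -> separated B -> ~ halvable B ->
  exists B', [/\ B' \in unitmx, separated B',
    forall z : 'rV[int]_d, exists w : 'rV[int]_d, iv z *m B = iv w *m B' &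
    exists z : 'rV[int]_d, forall w : 'rV[int]_d,
      iv z *m B' != iv w *m B].
Proof.
move=> uB sB /existsNP[z /forallNP zfar].
have {}zfar w : 1 <= N (2^-1 *: (iv z *m B) - iv w *m B).
  by rewrite leNgt; apply/negP; exact: zfar.
have [i zi] : exists i, odd (absz (z 0 i)).
  apply: contrapT => /forallNP ez.
  pose w : 'rV[int]_d := \row_i divz (z 0 i) 2.
  have zw : iv z = 2 *: iv w.
    apply/rowP => i; rewrite !mxE -[2]/(2%:~R) -intrM; congr _%:~R.
    by have := ez i; lia.
  have := zfar w.
  by rewrite zw scalemxAl scalerA mulVf // scale1r subrr N0 ler10.
(* P replaces the i-th row by half of z1, and Q is its integral inverse. *)
pose e := delta_mx 0 i : 'rV[int]_d.
pose z1 := z - (2 * divz (z 0 i) 2) *: e.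
have z1i : z1 0 i = 1.
  rewrite !mxE !eqxx mulr1; exact: odd_int_sub.
have ivD (a b : 'rV[int]_d) : iv (a + b) = iv a + iv b by rewrite map_mxD.
have ivN (a : 'rV[int]_d) : iv (- a) = - iv a by rewrite map_mxN.
have ivZ (k : int) (a : 'rV[int]_d) : iv (k *: a) = k%:~R *: iv a.
  by rewrite map_mxZ.
have {}zfar w : 1 <= N (2^-1 *: (iv z1 *m B) - iv w *m B).
  have := zfar (w + divz (z 0 i) 2 *: e).
  rewrite /z1 !(ivD, ivN, ivZ, mulmxDl, mulNmx) intrM -!scalemxAl.
  rewrite scalerBr scalerA mulrA mulVf // mul1r.
  by rewrite opprD addrA addrAC.
pose p : 'rV[R]_d := 2^-1 *: iv z1 - iv e.
pose P : 'M[R]_d := 1%:M + (iv e)^T *m p.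
pose q : 'rV[int]_d := 2 *: e - z1.
pose Q : 'M[int]_d := 1%:M + e^T *m q.
have iwe (w : 'rV[R]_d) : w *m (iv e)^T = (w 0 i)%:M.
  apply/rowP => j; rewrite ord1 !mxE eqxx mulr1n (bigD1 i) //= !mxE !eqxx mulr1.
  rewrite big1 ?addr0 // => k ki; rewrite !mxE eqxx /= (negPf ki) mulr0 //.
have ivQ (w : 'rV[int]_d) : iv (w *m Q) = iv w + (w 0 i)%:~R *: iv q.
  rewrite map_mxM /Q map_mxD map_mx1 map_mxM mulmxDr mulmx1 mulmxA.
  by rewrite -map_trmx iwe mul_scalar_mx mxE.
have wP (w : 'rV[R]_d) : w *m P = w + w 0 i *: p.
  by rewrite /P mulmxDr mulmx1 mulmxA iwe mul_scalar_mx.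
have qi : iv q 0 i = 1.
  have -> : iv q 0 i = (2 * e 0 i - z1 0 i)%:~R by rewrite !mxE.
  by rewrite z1i /e mxE !eqxx.
have QP : (1%:M + (iv e)^T *m iv q) *m P = 1%:M.
  rewrite mulmxDl mul1mx -mulmxA wP qi scale1r /P -addrA -mulmxDr.
  rewrite (_ : p + _ = 0) ?mulmx0 ?addr0 //.
  rewrite /p /q ivD ivN ivZ.
  by apply/rowP => j; rewrite !mxE; field.
have uP : P \in unitmx by have [] := mulmx1_unit QP.
exists (P *m B); split.
- by rewrite unitmx_mul uP.
- move=> w w0; rewrite mulmxA wP /p.
  have [m [wi|wi]] : exists m, w 0 i = 2 * m \/ w 0 i = 2 * m + 1.
    by exists (divz (w 0 i) 2); lia.
  + have E : iv w + (iv w) 0 i *: p = iv (w + m *: z1 - (2 * m) *: e).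
      rewrite !(ivD, ivN, ivZ) /p mxE wi; apply/rowP => j; rewrite !mxE.
      by rewrite intrM; field.
    rewrite -/p E; apply: sB; apply/eqP => E0; move: E.
    rewrite E0 map_mx0 -wP => /(congr1 (mulmx^~ (invmx P))).
    rewrite mulmxK // mul0mx => /rowP w0'; move/eqP: w0; apply.
    by apply/rowP => j; have := w0' j; rewrite !mxE => /eqP; rewrite intr_eq0 => /eqP.
  + have -> : iv w + (iv w) 0 i *: (2^-1 *: iv z1 - iv e) =
        2^-1 *: iv z1 - iv (- w - m *: z1 + (2 * m + 1) *: e).
      rewrite !(ivD, ivN, ivZ) mxE wi; apply/rowP => j; rewrite !mxE.
      by rewrite intrD intrM; field.
    by rewrite mulmxBl -scalemxAl; exact: zfar.
- move=> w; exists (w *m Q); rewrite ivQ mulmxA wP.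
  rewrite -!wP; congr (_ *m _).
  have := congr1 (mulmx (iv w)) QP.
  by rewrite mulmx1 mulmxA mulmxDr mulmx1 mulmxA iwe mul_scalar_mx => /esym; rewrite mxE.
- exists e => w; apply/eqP => E; have := zfar w.
  rewrite -E mulmxA wP mxE mxE !eqxx scale1r /p [iv e + _]addrC subrK -scalemxAl.
  by rewrite subrr N0 ler10.
Qed.

Let rows_norm (B : 'M[R]_d) := \sum_j N (row j B).

Let norm_mulmx_lt (u : 'rV[R]_d) (B : 'M[R]_d) (e : R) : 0 < e ->
  (forall j, `|u 0 j| <= e) -> e * rows_norm B < 1 -> N (u *m B) < 1.
Proof.
move=> e0 ue; apply: le_lt_trans; apply: le_trans (norm_mulmx_le _ _) _.
by rewrite mulr_sumr; apply: ler_sum => j _; exact: ler_wpM2r.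
Qed.

(** Refinement cannot go on for ever. Each refinement contributes a vector
    that is new modulo the first lattice; after translation into the unit cell
    of that lattice, these vectors still differ by nonzero vectors of a
    separated lattice, hence are at pairwise distance at least 1, whereas the
    cell is cut into finitely many cubes of diameter less than 1. *)
Lemma halvable_lattice : exists B, [/\ B \in unitmx, separated B & halvable B].
Proof.
apply: contrapT => noB.
have [B0 uB0 sB0] := separated_scalar.
have chain n : exists B (y : nat -> 'rV[R]_d), [/\ B \in unitmx, separated B,
    forall z : 'rV[int]_d, exists w : 'rV[int]_d, iv z *m B0 = iv w *m B,
    forall k, (k < n)%N -> exists z : 'rV[int]_d, y k = iv z *m B &
    forall j k, (j < k < n)%N -> forall w : 'rV[int]_d,
      y k - y j != iv w *m B0].
  elim: n => [|n [B [y [uB sB B0B yB yB0]]]].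
    exists B0, (fun=> 0); split => //; first by move=> z; exists z.
    by move=> j k; rewrite ltn0 andbF.
  have nhB : ~ halvable B by move=> hB; apply: noB; exists B.
  have [B' [uB' sB' BB' [z0 z0B]]] := refine_lattice _ uB sB nhB.
  exists B', (fun k => if k == n then iv z0 *m B' else y k); split => //.
  - by move=> z; have [w ->] := B0B z; exact: BB'.
  - move=> k; rewrite ltnS leq_eqVlt.
    have [_ _|kn /= kn'] := eqVneq k n; first by exists z0.
    by have [z ->] := yB _ kn'; exact: BB'.
  - move=> j k /andP[jk]; rewrite ltnS leq_eqVlt.
    have [kn _|kn /= kn'] := eqVneq k n; last first.
      rewrite ltn_eqF ?(ltn_trans jk) //; apply: yB0; exact/andP.
    rewrite ltn_eqF -?kn // => w; apply/eqP => E.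
    have [z yz] : exists z : 'rV[int]_d, y j = iv z *m B.
      by apply: yB; rewrite -kn.
    have [w' ww'] := B0B w.
    have := z0B (w' + z); rewrite map_mxD mulmxDl -ww' -yz -E.
    by rewrite subrK eqxx.
have rB0 : 0 <= rows_norm B0 by rewrite sumr_ge0.
pose K := (Num.truncn (rows_norm B0)).+1.
have BK : rows_norm B0 < K%:R by exact: truncnS_gt.
have K0 : 0 < K%:R :> R by rewrite ltr0n.
have [B [y [uB sB B0B yB yB0]]] := chain (#|{ffun 'I_d -> 'I_K}|.+1).
have [u yu] : exists u : nat -> 'rV[R]_d, forall k, y k = u k *m B0.
  by exists (fun k => y k *m invmx B0) => k; rewrite mulmxKV.
pose fl k : 'rV[int]_d := \row_j Num.floor (u k 0 j).
pose v k := u k - iv (fl k).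
have v01 k j : 0 <= v k 0 j < 1.
  by rewrite !mxE; exact: sub_floor_itv.
pose tr k j : nat := Num.truncn (K%:R * v k 0 j).
pose cell (k : 'I_(#|{ffun 'I_d -> 'I_K}|.+1)) : {ffun 'I_d -> 'I_K} :=
  [ffun j => inord (tr k j)].
have cell_le a b : cell a = cell b -> forall j, `|(v a - v b) 0 j| <= K%:R^-1.
  move=> /ffunP ab j; have := ab j; rewrite !ffunE => /(congr1 val) /=.
  have trK k : (tr k j < K)%N.
    have /andP[v0 v1] := v01 k j.
    rewrite -(ltr_nat R); apply: le_lt_trans (_ : K%:R * v k 0 j < _).
      by rewrite truncn_le // mulr_ge0 // ltW.
    by rewrite gtr_pMr.
  rewrite !inordK // => tab.
  have tv k : (tr k j)%:R <= K%:R * v k 0 j < (tr k j)%:R + 1.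
    have /andP[v0 _] := v01 k j.
    by rewrite natr1; apply: truncn_itv; exact: mulr_ge0 (ltW K0) v0.
  rewrite -div1r ler_pdivlMr // -[X in _ * X](ger0_norm (ltW K0)) -normrM ler_norml.
  have -> : (v a - v b) 0 j = v a 0 j - v b 0 j by rewrite !mxE.
  by have := tv a; have := tv b; rewrite tab; lra.
have [inj|] := pselect (injective cell).
  by have := leq_card cell inj; rewrite card_ord ltnn.
case => a0 b0 ab0; apply: contrapT => neq0.
have [a [b [ab cab]]] : exists a b : 'I_(#|{ffun 'I_d -> 'I_K}|.+1),
    (a < b)%N /\ cell a = cell b.
  have [|ba|E] := ltngtP a0 b0; first by exists a0, b0.
    by exists b0, a0.
  by case: neq0; exact: val_inj.
have [za yza] := yB _ (ltn_ord a); have [zb yzb] := yB _ (ltn_ord b).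
have [w ww] := B0B (fl a - fl b).
have small : N ((v b - v a) *m B0) < 1.
  apply: (@norm_mulmx_lt _ _ K%:R^-1); first by rewrite invr_gt0.
    exact: cell_le.
  by rewrite mulrC ltr_pdivrMr // mul1r.
have vE : (v b - v a) *m B0 = y b - y a + iv (fl a - fl b) *m B0.
  rewrite !yu -mulmxBl -mulmxDl /v map_mxB; congr (_ *m _).
  by apply/rowP => j; rewrite !mxE; ring.
have [E0|n0] := eqVneq (zb - za + w) 0; last first.
  have := sB _ n0; rewrite map_mxD map_mxB mulmxDl mulmxBl -ww -yza -yzb -vE.
  by rewrite leNgt small.
have := yB0 a b; rewrite ab ltn_ord => /(_ isT (fl b - fl a)).
have : iv (zb - za + w) *m B = 0 by rewrite E0 map_mx0 mul0mx.
rewrite map_mxD map_mxB mulmxDl mulmxBl -ww -yza -yzb => /eqP.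
by rewrite addr_eq0 -mulNmx -map_mxN opprB => ->.
Qed.

(** The vectors of the lattice divided by 2 ^ m are dense as m grows, and each
    of them is at distance less than 1 + 1/2 + 1/4 + ... = 2 from the
    lattice. *)
Lemma halvable_cover B : B \in unitmx -> halvable B ->
  forall x, exists w : 'rV[int]_d, N (x - iv w *m B) < 3.
Proof.
move=> uB hB x.
have dyadic m (z : 'rV[int]_d) : exists w : 'rV[int]_d,
    N (2^-1 ^+ m *: (iv z *m B) - iv w *m B) < 2.
  elim: m => [|m [w Nw]]; first by exists z; rewrite expr0 scale1r subrr N0.
  have [w' Nw'] := hB w; exists w'.
  apply: le_lt_trans (N_sub _ (2^-1 *: (iv w *m B)) _) _.
  rewrite exprS -scalerA -scalerBr N_scale ger0_norm //; lra.
pose m := Num.truncn (rows_norm B).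
have Bm : rows_norm B < 2 ^+ m.
  apply: lt_le_trans (truncnS_gt _) _.
  by rewrite -natrX ler_nat; exact: ltn_expl.
have [u xu] : exists u : 'rV[R]_d, x = u *m B.
  by exists (x *m invmx B); rewrite mulmxKV.
pose z : 'rV[int]_d := \row_j Num.floor (2 ^+ m * u 0 j).
have [w Nw] := dyadic m z; exists w.
apply: le_lt_trans (N_sub _ (2^-1 ^+ m *: (iv z *m B)) _) _.
have p0 : 0 < 2 ^+ m :> R by rewrite exprn_gt0.
rewrite (_ : 3 = 1 + 2 :> R); last by ring.
apply: ltrD => //.
have -> : x - 2^-1 ^+ m *: (iv z *m B) = (u - 2^-1 ^+ m *: iv z) *m B.
  by rewrite mulmxBl -xu scalemxAl.
apply: (@norm_mulmx_lt _ _ (2^-1 ^+ m)); first by rewrite exprn_gt0.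
  move=> j; rewrite !mxE exprVn -[u 0 j](mulKf (lt0r_neq0 p0)) -mulrBr.
  rewrite normrM ger0_norm ?invr_ge0 ?(ltW p0) // ler_piMr ?invr_ge0 ?(ltW p0) //.
  rewrite mulKf ?(lt0r_neq0 p0) //.
  by have /andP[f0 f1] := sub_floor_itv (2 ^+ m * u 0 j); rewrite ger0_norm ?f0 // ltW.
by rewrite exprVn mulrC ltr_pdivrMr // mul1r.
Qed.

(** Two distinct lattice vectors that are congruent modulo k + 1 differ by
    k + 1 times a nonzero lattice vector, so they are at distance at least
    k + 1. This replaces a comparison of volumes. *)
Lemma separated_packing B (k : nat) (s : seq 'rV[int]_d) :
  separated B -> uniq s ->
  {in s &, forall z w, N (iv (z - w) *m B) < k.+1%:R} ->
  (size s <= k.+1 ^ d)%N.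
Proof.
move=> sB us close.
pose r (z : 'rV[int]_d) : {ffun 'I_d -> 'I_k.+1} :=
  [ffun j => inord (absz (modz (z 0 j) k.+1))].
have rinj : {in s &, injective r}.
  move=> z w zs ws /ffunP rzw.
  have dv j : (z - w) 0 j \in dvdz k.+1.
    have := rzw j; rewrite !ffunE => /(congr1 val) /=.
    rewrite !inordK; first last.
    - by have := ltz_pmod (z 0 j) (isT : 0 < k.+1%:Z);
        have := modz_ge0 (z 0 j) (isT : k.+1%:Z != 0); lia.
    - by have := ltz_pmod (w 0 j) (isT : 0 < k.+1%:Z);
        have := modz_ge0 (w 0 j) (isT : k.+1%:Z != 0); lia.
    move=> E; have -> : (z - w) 0 j = z 0 j - w 0 j by rewrite !mxE.
    rewrite -eqz_mod_dvd; apply/eqP.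
    have := modz_ge0 (z 0 j) (isT : k.+1%:Z != 0).
    have := modz_ge0 (w 0 j) (isT : k.+1%:Z != 0). lia.
  pose y : 'rV[int]_d := \row_j divz ((z - w) 0 j) k.+1.
  have zwy : iv (z - w) = k.+1%:R *: iv y.
    apply/rowP => j; rewrite [LHS]mxE -{1}(divzK (dv j)) !mxE.
    by rewrite intrM mulrC.
  have [y0|y0] := eqVneq y 0.
    apply/eqP; rewrite -subr_eq0; apply/eqP/rowP => j.
    have := dv j => /divzK <-; move/rowP: y0 => /(_ j); rewrite !mxE => ->.
    by rewrite mul0r.
  have := close _ _ zs ws; rewrite zwy -scalemxAl N_scale ger0_norm //.
  by rewrite ltNge ler_pMr ?ltr0n // sB.
have -> : (k.+1 ^ d)%N = #|{ffun 'I_d -> 'I_k.+1}| by rewrite card_ffun !card_ord.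
rewrite -(size_map r); apply: leq_trans (max_card (mem [seq r z | z <- s])).
by rewrite (card_uniqP _) // map_inj_in_uniq.
Qed.

End Lattice.

Import VectorInternalTheory.

(** All that is kept of the geometry: [s] is the set of differences of rounded
    positions across pairs at distance at most 1. The factor 6 makes two points
    with the same rounding closer than 2 * 3 / 6 = 1; then the elements of [s]
    are lattice vectors of norm less than 6 + 3 + 3 = 12. *)
Lemma lattice_rounding (R : realType) (X : normedVectType R) (T : finType)
    (p : T -> X) :
  exists (k : nat) (l : T -> 'rV[int]_k) (s : seq 'rV[int]_k),
  [/\ (size s <= 24 ^ \dim {:X})%N,
      forall v w, l v = l w -> `|p v - p w| <= 1 &
      forall v w, `|p v - p w| <= 1 -> l v - l w \in s].
Proof.
pose N (u : 'rV[R]_(dim X)) := `|r2v u : X|.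
have N_add u v : N (u + v) <= N u + N v.
  by rewrite /N linearD; exact: ler_normD.
have N_scale a u : N (a *: u) = `|a| * N u by rewrite /N linearZ normrZ.
have N_eq0 u : N u = 0 -> u = 0.
  by move=> /normr0_eq0 u0; apply: r2v_inj; rewrite u0 linear0.
have [B [uB sB hB]] := halvable_lattice N N_add N_scale N_eq0.
have cov x := halvable_cover N N_add N_scale B uB hB x.
pose L (z : 'rV[int]_(dim X)) : X := r2v (map_mx intr z *m B).
have LB (z w : 'rV[int]_(dim X)) : L (z - w) = L z - L w.
  by rewrite /L map_mxB mulmxBl linearB.
have cov' v : exists z, `|6 *: p v - L z| < 3.
  by have [w] := cov (v2r (6 *: p v)); rewrite /N linearB /= v2rK; exists w.
have [l lP] := choice cov'.
have n6 (x : X) : `|6 *: x| = 6 * `|x| by rewrite normrZ ger0_norm.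
pose s := undup [seq l v - l w | v <- enum T,
                                 w <- [seq w <- enum T | `|p v - p w| <= 1]].
exists (dim X), l, s; split.
- rewrite dimvf; apply: (separated_packing N N_scale B 23 s sB).
    exact: undup_uniq.
  have L12 z : z \in s -> `|L z| < 12.
    rewrite mem_undup => /allpairsPdep[v [w [_ ]]].
    rewrite mem_filter => /andP[vw _] ->; rewrite LB.
    have -> : L (l v) - L (l w) =
        6 *: (p v - p w) - (6 *: p v - L (l v)) + (6 *: p w - L (l w)).
      by rewrite scalerBr opprB [_ + (L (l v) - _)]addrC
        !addrA !subrK.
    apply: le_lt_trans (ler_normD _ _) _; have := lP w; have := lP v.
    have := ler_normB (6 *: (p v - p w)) (6 *: p v - L (l v)).
    by rewrite n6; lra.
  move=> z w zs ws; change (`|L (z - w)| < 24%:R); rewrite LB.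
  apply: le_lt_trans (ler_normB _ _) _.
  by have := L12 z zs; have := L12 w ws; lra.
- move=> v w lvw; have := lP v; have := lP w; rewrite lvw => pw pv.
  have : `|6 *: (p v - p w)| <= `|6 *: p v - L (l w)| + `|6 *: p w - L (l w)|.
    by apply: le_trans (ler_normB _ _); rewrite scalerBr opprB addrA subrK.
  by rewrite n6; lra.
- move=> v w vw; rewrite mem_undup; apply/allpairsPdep.
  exists v, w; split; [exact: mem_enum | | by []].
  by rewrite mem_filter /= vw; exact: mem_enum.
Qed.
(** * Encoding of graphs *)

(** A spanning forest, each component being rooted at its canonical
    representative and the parent of a vertex being its successor on a
    shortest path to the root. As depths are less than #|T|, iterating #|T|
    times always ends at the root, where [f] is stationary: this exponent
    spares any mention of roots in the encoding. *)
Lemma parent_function (T : finType) (e : rel T) : symmetric e ->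
  exists f : T -> T, (forall v, f v = v \/ e v (f v)) /\
    forall v w, e v w -> iter #|T| f v = iter #|T| f w.
Proof.
move=> esym; have csym : connect_sym e by exact: sym_connect_sym.
pose r := fingraph.root e.
have rr v w : e v w -> r v = r w.
  by move=> vw; rewrite /r; apply/(fingraph.rootP csym); exact: connect1.
pose P v k := [exists p : k.-tuple T, path e v p && (last v p == r v)].
have exP v : exists k, P v k && (k < #|T|)%N.
  have /connectP[p0 pp0] := connect_root e v.
  case/shortenP: pp0 => p pp up _ lp; exists (size p).
  apply/andP; split; first by apply/existsP; exists (in_tuple p); rewrite pp -lp /=.
  by have := max_card (mem (v :: p)); rewrite (card_uniqP up).
have exP' v : exists k, P v k by have [k /andP[Pk _]] := exP v; exists k.
pose h v := ex_minn (exP' v).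
have hP v : P v (h v) by rewrite /h; case: ex_minnP.
have h_min v k : P v k -> (h v <= k)%N.
  by rewrite /h; case: ex_minnP => m _ mmin /mmin.
have h_lt v : (h v < #|T|)%N.
  by have [k /andP[/h_min hk kT]] := exP v; exact: leq_ltn_trans hk kT.
have h0 v : h v = 0%N -> r v = v.
  move=> hv; have := hP v; rewrite hv => /existsP[p].
  by rewrite tuple0 /= => /eqP.
have /choice[f fP] : forall v, exists w,
    (h v = 0%N /\ w = v) \/ (e v w /\ (h w < h v)%N).
  move=> v; case E : (h v) => [|k]; first by exists v; left.
  have := hP v; rewrite E => /existsP[p /andP[]].
  case/tupleP: p => x p /= /andP[vx xp] lp; exists x; right; split => //.
  by rewrite ltnS; apply: h_min; apply/existsP; exists p; rewrite xp -(rr v).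
exists f; split => [v|].
  by case: (fP v) => [[_ ->]|[? _]]; [left|right].
have iter_root m v : (h v <= m)%N -> iter m f v = r v.
  elim: m v => [|m IH] v hm; first by rewrite h0 //; lia.
  rewrite iterSr; case: (fP v) => [[hv ->]|[vf hf]]; first by apply: IH; rewrite hv.
  by rewrite IH ?(rr v (f v)) //; lia.
by move=> v w vw; rewrite !iter_root ?(rr v w) // ltnW.
Qed.

Section Code.
Variables (T : finType) (D M : nat).
Local Notation n := #|T|.

(** Integer vectors with entries between - (n + 1) and n + 1, shifted to be
    nonnegative; they contain the differences of path vectors, minus one
    step. *)
Definition box := {ffun 'I_M.+1 -> 'I_(n.*2.+3)}.

Definition box_vector (g : box) : 'rV[rat]_M.+1 :=
  \row_j ((g j)%:R - n.+1%:R).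

Definition box_matrix (A : {ffun 'I_M.+1 -> box}) : 'M[rat]_M.+1 :=
  \matrix_i box_vector (A i).

(** The trace on the box of the kernel of a linear map is also the trace of the
    subspace spanned by this trace, which has a basis consisting of at most
    M + 1 vectors of the box. Hence the map itself can be forgotten: the number
    of possible traces is bounded independently of [k] and [L]. *)
Lemma kernel_box_basis k (L : 'M[rat]_(M.+1, k)) :
  exists A : {ffun 'I_M.+1 -> box}, forall g : box,
    (box_vector g <= box_matrix A)%MS = (box_vector g *m L == 0).
Proof.
pose Z := [set g : box | box_vector g *m L == 0]%SET.
pose W := \matrix_(i < #|Z|) box_vector (enum_val i).
have [z0 z0Z] : exists g : box, g \in Z.
  exists [ffun=> inord n.+1]; rewrite inE (_ : box_vector _ = 0) ?mul0mx //.
  by apply/rowP => j; rewrite !mxE ffunE inordK ?subrr //; lia.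
(* When the rank is less than M + 1, [z0] fills the remaining places. *)
pose A : {ffun 'I_M.+1 -> box} := [ffun i : 'I_M.+1 =>
  if insub (val i) is Some i' then enum_val (maxrankfun W i') else z0].
exists A => g; apply/idP/eqP => [/submxP[C ->]|gL].
  rewrite -mulmxA (_ : box_matrix A *m L = 0) ?mulmx0 //.
  apply/row_matrixP => i; rewrite row_mul rowK row0 ffunE.
  case: insubP => [i' _ _|_]; last by move: z0Z; rewrite inE => /eqP.
  by have := enum_valP (maxrankfun W i'); rewrite inE => /eqP.
have gZ : g \in Z by rewrite inE gL.
have -> : box_vector g = row (enum_rank_in gZ g) W.
  by rewrite rowK enum_rankK_in.
apply: (submx_trans (row_sub _ _)); rewrite -(eq_maxrowsub W).
apply/row_subP => i; rewrite row_rowsub rowK.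
have iM : (i < M.+1)%N by apply: leq_trans (ltn_ord i) (rank_leq_col _).
suff -> : box_vector (enum_val (maxrankfun W i)) =
    row (Ordinal iM) (box_matrix A) by exact: row_sub.
rewrite rowK ffunE insubT //= => iW; congr (box_vector (enum_val (maxrankfun W _))).
exact: val_inj.
Qed.

(** Parent function, step from the parent to each vertex, vectors spanning the
    relations between steps, and names of the neighbours: a step and a rank
    among the vertices rounded to the same point. *)
Definition graph_code : finType :=
  (({ffun T -> T} * {ffun T -> 'I_M.+1}) *
   ({ffun 'I_M.+1 -> box} * {ffun T * 'I_D -> 'I_M.+1 * 'I_D.+1}))%type.

Lemma card_graph_code : #|{: graph_code}| =
  ((n ^ n * M.+1 ^ n) *
   (((n.*2.+3 ^ M.+1) ^ M.+1) * (M.+1 * D.+1) ^ (n * D)))%N.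
Proof. by rewrite !card_prod !card_ffun !card_prod !card_ord. Qed.

(** The formal sum of the steps on the way from [v] to its root. Past the root,
    the path stays there and only contributes the label of the zero step. *)
Definition path_vector (f : T -> T) (lab : T -> 'I_M.+1) v : 'rV[rat]_M.+1 :=
  \sum_(t < n) delta_mx 0 (lab (iter t f v)).

(** For the code of a rounded graph, these are the vertices of the component of
    [v] whose rounded position is that of [v] plus the [i]-th step. *)
Definition fiber (f : T -> T) (lab : T -> 'I_M.+1)
    (A : {ffun 'I_M.+1 -> box}) v i : {set T} :=
  [set w | (iter n f w == iter n f v) &&
    (path_vector f lab w - path_vector f lab v - delta_mx 0 i
       <= box_matrix A)%MS]%SET.

Definition decoded_neighbour (c : graph_code) v (k : 'I_D) : T :=
  let ij := c.2.2 (v, k) in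
  nth v (enum (fiber c.1.1 c.1.2 c.2.1 v ij.1)) ij.2.

Definition decode (c : graph_code) : {set {set T}} :=
  [set [set vk.1; decoded_neighbour c vk.1 vk.2]%SET | vk : T * 'I_D]%SET.

Lemma path_vector_box f lab v w i : exists g : box,
  path_vector f lab w - path_vector f lab v - delta_mx 0 i = box_vector g.
Proof.
pose a u j := \sum_(t < n) (j == lab (iter t f u) : nat).
have aE u j : path_vector f lab u 0 j = (a u j)%:R.
  rewrite /path_vector summxE natr_sum; apply: eq_bigr => t _.
  by rewrite mxE eqxx.
have an u j : (a u j <= n)%N.
  rewrite -[X in (_ <= X)%N]card_ord -sum1_card; apply: leq_sum => t _.
  by case: (_ == _).
exists [ffun j => inord (a w j + n.+1 - a v j - (j == i))].
apply/rowP => j; rewrite [RHS]mxE ffunE.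
have -> : (path_vector f lab w - path_vector f lab v - delta_mx 0 i) 0 j =
    path_vector f lab w 0 j - path_vector f lab v 0 j - (j == i)%:R.
  by rewrite !mxE eqxx.
rewrite !aE inordK; have := an w j; have := an v j; move=> h1 h2; last by lia.
by rewrite !natrB ?natrD; [ring|lia|case: (j == i); lia].
Qed.

(** Along the forest the steps telescope, so that the linear map [L] sending
    formal steps to their values maps [path_vector f lab v] to the difference
    of the rounded positions of [v] and of its root. Therefore fibres are sets
    of vertices rounded to a common point; these are cliques, of at most D + 1
    vertices by regularity, and each neighbour of [v] has a rank in its own
    fibre. *)
Lemma regular_graph_is_decoded (G : simple_graph T) k
    (l : T -> 'rV[int]_k) (s : seq 'rV[int]_k) :
  (forall v, #|[set w | adj G v w]%SET| = D) ->
  (size s <= M.+1)%N ->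
  (forall v w, l v = l w -> v != w -> adj G v w) ->
  (forall v w, adj G v w || (v == w) -> l v - l w \in s) ->
  exists c : graph_code, edges G = decode c.
Proof.
move=> regG sM clique adj_s.
have adjC : symmetric (adj G) by move=> v w; rewrite /adj finset.setUC.
have adj_neq v w : adj G v w -> v != w.
  move=> vw; have /forall_inP/(_ _ vw) := edges_card2 G.
  by rewrite cards2; case: (v != w).
have [f [f_step f_root]] := parent_function T (adj G) adjC.
pose idx (z : 'rV[int]_k) : 'I_M.+1 := inord (index z s).
pose L : 'M[rat]_(M.+1, k) := \matrix_i (map_mx intr (nth 0 s i)).
have idxL z : z \in s -> delta_mx 0 (idx z) *m L = map_mx intr z.
  move=> zs; rewrite -rowE rowK inordK ?nth_index //.
  by apply: leq_trans sM; rewrite index_mem.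
pose lab := [ffun v => idx (l v - l (f v))].
have labL v : path_vector f lab v *m L = map_mx intr (l v - l (iter n f v)).
  rewrite /path_vector mulmx_suml.
  elim: n v => [|m IH] v; first by rewrite big_ord0 subrr map_mx0.
  rewrite big_ord_recr /= IH ffunE idxL.
    by rewrite -map_mxD addrA subrK.
  by apply: adj_s; case: (f_step (iter m f v)) => ->; rewrite ?eqxx ?orbT.
have [A AP] := kernel_box_basis k L.
have fiberE v z w : z \in s ->
    (w \in fiber f lab A v (idx z)) =
    (iter n f w == iter n f v) && (l w - l v == z).
  move=> zs; rewrite inE; case: eqP => //= wv.
  have [g gE] := path_vector_box f lab v w (idx z).
  rewrite gE AP -gE !mulmxBl !labL idxL // wv -!map_mxB.
  rewrite opprB addrA subrK -[_ == z]subr_eq0.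
  apply/eqP/eqP => [/rowP E|->]; last by rewrite map_mx0.
  apply/rowP => j; have := E j; rewrite mxE [RHS]mxE => /eqP.
  by rewrite intr_eq0 => /eqP ->; rewrite mxE.
pose nbr v (j : 'I_D) := nth v (enum [set w | adj G v w]%SET) j.
have nbrP v j : adj G v (nbr v j).
  have : nbr v j \in enum [set w | adj G v w]%SET.
    by rewrite mem_nth // -cardE regG.
  by rewrite mem_enum inE.
pose lbl v j := idx (l (nbr v j) - l v).
pose F v j := enum (fiber f lab A v (lbl v j)).
have nbr_s v j : l (nbr v j) - l v \in s.
  by apply: adj_s; rewrite adjC nbrP.
have nbrF v j : nbr v j \in F v j.
  by rewrite mem_enum fiberE // eqxx andbT (f_root _ _ (nbrP v j)).
have sizeF v j : (size (F v j) <= D.+1)%N.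
  rewrite -cardE; apply: leq_trans (_ : #|nbr v j |:
      [set w | adj G (nbr v j) w]%SET| <= _)%N; last first.
    by rewrite cardsU1 regG; case: (_ \notin _); rewrite // addnC.
  apply: subset_leq_card; apply/fintype.subsetP => w.
  rewrite fiberE // !inE => /andP[_ /eqP lw].
  have [//|wn /=] := eqVneq w (nbr v j).
  by apply: clique; rewrite 1?eq_sym //; apply/esym/(addIr (- l v)).
pose nb : {ffun T * 'I_D -> 'I_M.+1 * 'I_D.+1} :=
  [ffun vj => (lbl vj.1 vj.2, inord (index (nbr vj.1 vj.2) (F vj.1 vj.2)))].
pose c : graph_code := (([ffun v => f v], lab), (A, nb)).
have ff : ([ffun v => f v] : T -> T) = f by apply/funext => v; rewrite ffunE.
have cE v j : decoded_neighbour c v j = nbr v j.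
  rewrite /decoded_neighbour /c /= ff ffunE /= inordK ?nth_index //.
  by apply: leq_trans (sizeF v j); rewrite index_mem.
exists c; apply/finset.setP => e; apply/idP/imsetP => [eG|[[v j] _ ->]]; last first.
  by rewrite cE; exact: nbrP.
have /forall_inP/(_ _ eG) := edges_card2 G.
move=> /cards2P[v [w [_ eE]]].
have wN : w \in enum [set w | adj G v w]%SET.
  by rewrite mem_enum inE /adj -eE.
have iw : (index w (enum [set w | adj G v w]%SET) < D)%N.
  by rewrite -(regG v) cardE index_mem.
exists (v, Ordinal iw); first by [].
by rewrite /= cE /nbr /= nth_index.
Qed.

End Code.
(** * Many regular graphs *)

Definition rel_graph_edges {T : finType} (e : rel T) : {set {set T}} :=
  [set [set p.1; p.2]%SET | p : T * T & (p.1 != p.2) && e p.1 p.2]%SET.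

Lemma rel_graph_edges_card2 {T : finType} (e : rel T) :
  [forall A in rel_graph_edges e, #|A| == 2].
Proof.
apply/forall_inP => A /imsetP[[v w]]; rewrite inE /= => /andP[vw _] ->.
by rewrite cards2 vw.
Qed.

Definition rel_graph {T : finType} (e : rel T) : simple_graph T :=
  SimpleGraph (rel_graph_edges_card2 e).

Lemma adj_rel_graph {T : finType} (e : rel T) (v w : T) :
  symmetric e -> irreflexive e -> adj (rel_graph e) v w = e v w.
Proof.
move=> esym eirr; apply/imsetP/idP => [[[a b]]|vw]; last first.
  exists (v, w) => //; rewrite inE /= vw andbT.
  by apply/eqP => vw'; rewrite vw' eirr in vw.
rewrite inE /= => /andP[ab eab] E.
have : v \in [set a; b]%SET by rewrite -E set21.
have : w \in [set a; b]%SET by rewrite -E set22.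
have vw : v != w.
  have := congr1 (fun s : {set T} => #|s|) E; rewrite !cards2 ab.
  by case: (v != w).
by rewrite !inE => /orP[]/eqP wE /orP[]/eqP vE; move: vw;
  rewrite wE vE ?eqxx // => _; rewrite // esym.
Qed.

Section Circulant.
Variables (D h : nat).
Hypothesis D_lt_h : (D < h.+1)%N.
Hypothesis even_degree_sum : ~~ odd (D * h.+1).

(** The steps +1, -1, ..., + D./2, - D./2 modulo h + 1, together with the
    antipodal step when D is odd, in which case h + 1 is even. *)
Definition circulant_step (x : nat) : bool :=
  [&& 0 < x & [|| x <= D./2, h.+1 <= x + D./2 | odd D && (x.*2 == h.+1)]]%N.

Definition circulant : rel 'I_h.+1 := fun x y => circulant_step (y - x)%R.

Lemma circulant_stepN (x : 'I_h.+1) : circulant_step (- x)%R = circulant_step x.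
Proof.
rewrite /circulant_step /=; have [->|x0] := posnP x.
  by rewrite subn0 modnn.
have xh := ltn_ord x.
by rewrite modn_small; [apply/idP/idP; lia|lia].
Qed.

Lemma card_circulant_step : #|[set x : 'I_h.+1 | circulant_step x]%SET| = D.
Proof.
pose F (k : 'I_D) : 'I_h.+1 := inord
  (if (k < D./2)%N then k.+1
   else if (k < D./2.*2)%N then (h.+1 + k - D./2.*2)%N else h.+1./2).
move: even_degree_sum; rewrite oddM => ev.
have FE k : F k = (if (k < D./2)%N then k.+1
   else if (k < D./2.*2)%N then (h.+1 + k - D./2.*2)%N else h.+1./2) :> nat.
  rewrite inordK //; have := ltn_ord k; case: ifP => ?; last case: ifP => ?; lia.
rewrite -[RHS]card_ord -cardsT -(card_imset _ (_ : injective F)); last first.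
  move=> a b /(congr1 val); rewrite /= !FE => ab; apply: val_inj => /=.
  have := ltn_ord a; have := ltn_ord b; move: ab.
  by repeat case: ifP => ?; lia.
apply: eq_card => x; rewrite inE.
apply/idP/imsetP => [|[k _ ->]]; last first.
  rewrite /circulant_step FE; have := ltn_ord k.
  by repeat case: ifP => ?; lia.
rewrite /circulant_step => /andP[x0 /or3P[xD|xD|/andP[oD xD]]].
- have kD : (x.-1 < D)%N by lia.
  exists (Ordinal kD) => //; apply: val_inj; rewrite /= FE /=.
  by repeat case: ifP => ?; lia.
- have kD : (x + D./2.*2 - h.+1 < D)%N by have := ltn_ord x; lia.
  exists (Ordinal kD) => //; apply: val_inj; rewrite /= FE /=.
  by have := ltn_ord x; repeat case: ifP => ?; lia.
- have kD : (D./2.*2 < D)%N by lia.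
  exists (Ordinal kD) => //; apply: val_inj; rewrite /= FE /=.
  by repeat case: ifP => ?; lia.
Qed.

Lemma circulant_sym : symmetric circulant.
Proof. by move=> x y; rewrite /circulant -circulant_stepN opprB. Qed.

Lemma circulant_irr : irreflexive circulant.
Proof. by move=> x; rewrite /circulant subrr. Qed.

Lemma card_circulant x : #|[set y | circulant x y]%SET| = D.
Proof.
rewrite -[RHS]card_circulant_step -[RHS](card_imset _ (addIr x)).
apply: eq_card => y; rewrite inE.
apply/idP/imsetP => [xy|[c]]; last by rewrite inE /circulant => ? ->; rewrite addrK.
by exists (y - x); rewrite ?inE ?subrK.
Qed.

End Circulant.

Section Lifts.
Variables (D q h : nat).
Hypothesis D_lt_h : (D < h.+1)%N.
Hypothesis even_degree_sum : ~~ odd (D * h.+1).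

(** A vertex [inl (b, i, u)] is the copy number [u] of the [i]-th vertex on the
    side [b] of K_{D,D}. *)
Definition lift_vertex : finType := ((bool * 'I_D * 'I_q) + 'I_h.+1)%type.

Definition lift_rel (s : {ffun 'I_D * 'I_D -> 'S_q}) : rel lift_vertex :=
  fun x y => match x, y with
  | inl (false, i, u), inl (true, j, w) => s (i, j) u == w
  | inl (true, j, w), inl (false, i, u) => s (i, j) u == w
  | inr a, inr b => circulant D h a b
  | _, _ => false
  end.

Lemma lift_rel_sym s : symmetric (lift_rel s).
Proof.
by move=> [[[[] i] u]|a] [[[[] j] w]|b] //=; exact: circulant_sym.
Qed.

Lemma lift_rel_irr s : irreflexive (lift_rel s).
Proof. by move=> [[[[] i] u]|a] //=; exact: circulant_irr. Qed.

Lemma card_lift_rel s x : #|[set y | lift_rel s x y]%SET| = D.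
Proof.
case: x => [[[[] i] u]|a].
- pose F j : lift_vertex := inl (false, j, (s (j, i))^-1%g u).
  rewrite -[RHS]card_ord -cardsT -(card_imset _ (_ : injective F)); last by move=> ? ? [].
  apply: eq_card => -[[[[] j] w]|b]; rewrite !inE /=;
    apply/idP/imsetP => //; try by case=> ? _.
  + by move=> /eqP wu; exists j => //; rewrite /F -wu permK.
  + by case=> ? _ [-> ->]; rewrite permKV.
- pose F j : lift_vertex := inl (true, j, s (i, j) u).
  rewrite -[RHS]card_ord -cardsT -(card_imset _ (_ : injective F)); last by move=> ? ? [].
  apply: eq_card => -[[[[] j] w]|b]; rewrite !inE /=;
    apply/idP/imsetP => //; try by case=> ? _.
  + by move=> /eqP<-; exists j.
  + by case=> ? _ [-> ->].
- rewrite -[RHS](@card_circulant D h _ _ a) //.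
  rewrite -[RHS](card_imset _ (_ : injective (inr : _ -> lift_vertex))); last by move=> ? ? [].
  apply: eq_card => -[[[[] j] w]|b]; rewrite !inE /=;
    apply/idP/imsetP => //; try by case=> ? _.
  + by move=> ab; exists b; rewrite ?inE.
  + by case=> c; rewrite inE => ? [->].
Qed.

Lemma card_lift_vertex : #|lift_vertex| = (2 * D * q + h.+1)%N.
Proof. by rewrite card_sum !card_prod card_bool !card_ord. Qed.

(** The permutations of a lift can be read off the graph, because the two copies
    joined by an edge determine which edge of K_{D,D} it lies over; thus lifts
    of a labelled base graph are simple and pairwise distinct. *)
Lemma regular_graphs_lower_bound :
  (q`! ^ (D * D) <= #|regular_graphs (2 * D * q + h.+1) D|)%N.
Proof.
pose phi (v : 'I_(2 * D * q + h.+1)) : lift_vertex :=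
  enum_val (cast_ord (esym card_lift_vertex) v).
pose psi (x : lift_vertex) := cast_ord card_lift_vertex (enum_rank x).
have psiK : cancel psi phi by move=> x; rewrite /phi /psi cast_ordK enum_rankK.
have phiK : cancel phi psi by move=> x; rewrite /phi /psi enum_valK cast_ordKV.
pose G s := rel_graph (relpre phi (lift_rel s)).
have adjG s v w : adj (G s) v w = lift_rel s (phi v) (phi w).
  rewrite adj_rel_graph //; first by move=> ? ?; exact: lift_rel_sym.
  by move=> ?; exact: lift_rel_irr.
have Ginj : injective G.
  move=> s t st; apply/ffunP => -[i j]; apply/permP => u.
  have := adjG t (psi (inl (false, i, u))) (psi (inl (true, j, s (i, j) u))).
  by rewrite -st adjG !psiK /= eqxx => /esym/eqP.
have <- : #|{ffun 'I_D * 'I_D -> 'S_q}| = (q`! ^ (D * D))%N.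
  by rewrite card_ffun card_prod !card_ord card_Sn.
rewrite -cardsT -(card_imset _ Ginj); apply: subset_leq_card.
apply/fintype.subsetP => _ /imsetP[s _ ->]; rewrite inE; apply/forallP => v.
rewrite -[X in _ == X](card_lift_rel s (phi v)).
rewrite -(@on_card_preimset _ _ phi); last by exists psi => ? _.
by apply/eqP; apply: eq_card => w; rewrite !inE adjG.
Qed.

End Lifts.
(** * Comparison of the two counts *)

Lemma leq_expn_base e a b : (a <= b)%N -> (a ^ e <= b ^ e)%N.
Proof. by case: e => // e ab; rewrite leq_exp2r. Qed.

(** The central binomial coefficient is at most 4 ^ q and at least
    q ^ q / q!. *)
Lemma expn_le_fact q : (q ^ q <= 4 ^ q * q`!)%N.
Proof.
have ffact_ge m : (m <= q)%N -> (q ^ m <= (q + q) ^_ m)%N.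
  elim: m => [|m IH] mq; first by rewrite expn0 ffactn0.
  by rewrite expnSr ffactnSr leq_mul ?IH //; lia.
apply: leq_trans (ffact_ge q (leqnn q)) _.
rewrite -bin_ffact leq_mul2r; apply/orP; right.
have -> : (4 ^ q = 2 ^ (q + q))%N by rewrite addnn -mul2n expnM.
rewrite -[2%N]/(1 + 1)%N expnDn (bigD1 (inord q)) //= inordK; last by lia.
by rewrite !exp1n !muln1 leq_addr.
Qed.

Definition code_bound (n M D : nat) :=
  ((n ^ n * M ^ n) * (((n.*2.+3 ^ M) ^ M) * (M * D.+1) ^ (n * D)))%N.

(** Both sides are raised to the power 16, which turns M ^ 16 <= n into integral
    exponents of n. Up to lower order factors, collected in [X] and [W], the
    codes contribute exponent 17 n + n D and the graphs 8 D n; the difference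
    (7 D - 17) n exceeds D n, which absorbs the constants to the power n D, by
    at least n, which absorbs the relations between steps since M ^ 2 is small
    compared with n. *)
Lemma code_bound_lt_graphs D : (3 <= D)%N ->
  exists n0, forall n q h M, (n0 <= n)%N -> n = (2 * D * q + h)%N ->
    (h <= 4 * D)%N -> (0 < M)%N -> (M ^ 16 <= n)%N ->
    (code_bound n M D * n <= q`! ^ (D * D))%N.
Proof.
move=> D3.
(* W and X are abstract so that the arithmetic below treats them as atoms. *)
have [W WE] : exists W, W = (D.+1 ^ 16 * (16 * D) ^ 8)%N by eexists.
exists (W + (64 * 64 + (64 * D ^ 2 + 32 + 8 * D)))%N.
move=> n q h M nn0 nE h4 M0 Mn.
have nW : (W <= n)%N by apply: leq_trans nn0; exact: leq_addr.
have n64 : (64 * 64 <= n)%N.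
  by apply: leq_trans nn0; apply: leq_trans (leq_addl _ _); exact: leq_addr.
have nD : (64 * D ^ 2 + 32 + 8 * D <= n)%N.
  apply: leq_trans nn0; apply: leq_trans (leq_addl _ _); exact: leq_addl.
have {}nn0 : (8 * D + 32 <= n)%N by clear WE; lia.
have n0 : (0 < n)%N by clear WE; lia.
have [X XE] : exists X, X = (n ^ (8 * D * h) * (16 * D) ^ (8 * n * D))%N.
  by eexists.
have X0 : (0 < X)%N by rewrite XE muln_gt0 !expn_gt0 n0 muln_gt0 (ltn_trans _ D3).
have lower : (n ^ (8 * D * n) <= (q`! ^ (D * D)) ^ 16 * X)%N.
  rewrite XE; clear WE XE X0 nW Mn; have n4q : (n <= 4 * D * q)%N by lia.
  have E : (8 * D * n = q * (16 * D * D) + 8 * D * h)%N by rewrite {1}nE; ring.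
  rewrite E expnD [leqLHS]mulnC [leqRHS]mulnCA leq_mul2l; apply/orP; right.
  apply: (@leq_trans ((4 * D * q) ^ (q * (16 * D * D)))).
    exact: leq_expn_base.
  rewrite expnM expnMn.
  apply: (@leq_trans (((4 * D) ^ q * (4 ^ q * q`!)) ^ (16 * D * D))).
    by apply: leq_expn_base; rewrite leq_mul2l expn_le_fact orbT.
  rewrite mulnA -expnMn (_ : 4 * D * 4 = 16 * D)%N; last by ring.
  rewrite expnMn mulnC (_ : (16 * D * D = D * D * 16)%N); last by ring.
  rewrite [(q`! ^ _)%N]expnM leq_mul2l; apply/orP; right.
  clear -n0 nE D3; by rewrite -expnM leq_pexp2l //; [lia|nia].
have small : (64 * M ^ 2 <= n)%N.
  rewrite -(@leq_exp2r _ _ 2) // expnMn -expnM.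
  have M4 : (M ^ 4 <= n)%N by apply: leq_trans Mn; rewrite leq_pexp2l.
  by apply: leq_trans (leq_mul n64 M4).
have upper : ((code_bound n M D * n) ^ 16 * X <= n ^ (8 * D * n))%N.
  have b2 : ((M ^ n) ^ 16 <= n ^ n)%N by rewrite expnAC leq_expn_base.
  have b3 : (((n.*2.+3 ^ M) ^ M) ^ 16 <= n ^ (32 * M ^ 2))%N.
    apply: (@leq_trans ((((n ^ 2) ^ M) ^ M) ^ 16)).
      by do 3!apply: leq_expn_base; clear -n0 nn0; nia.
    by rewrite -!expnM leq_pexp2l //; lia.
  have b4 : (((M * D.+1) ^ (n * D)) ^ 16 <=
      n ^ (n * D) * (D.+1 ^ 16) ^ (n * D))%N.
    by rewrite expnAC expnMn expnMn leq_mul2r leq_expn_base ?orbT.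
  have b5 : (W ^ (n * D) <= n ^ (n * D))%N by exact: leq_expn_base.
  rewrite XE; have -> : ((16 * D) ^ (8 * n * D) = ((16 * D) ^ 8) ^ (n * D))%N.
    by rewrite -(expnM _ 8) mulnA.
  rewrite /code_bound !(expnMn _ _ 16).
  apply: (@leq_trans (((n ^ n) ^ 16 * n ^ n) *
     (n ^ (32 * M ^ 2) * (n ^ (n * D) * (D.+1 ^ 16) ^ (n * D))) * n ^ 16 *
     (n ^ (8 * D * h) * ((16 * D) ^ 8) ^ (n * D)))).
    by do 2?[apply: leq_mul => //]; apply: leq_mul => //; apply: leq_mul.
  have -> : (((n ^ n) ^ 16 * n ^ n) *
     (n ^ (32 * M ^ 2) * (n ^ (n * D) * (D.+1 ^ 16) ^ (n * D))) * n ^ 16 *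
     (n ^ (8 * D * h) * ((16 * D) ^ 8) ^ (n * D)) =
     n ^ (n * 16 + n + 32 * M ^ 2 + n * D + 16 + 8 * D * h) * W ^ (n * D))%N.
    rewrite WE -(expnM n n 16) (expnMn (D.+1 ^ 16)) !expnD.
    move: (n ^ (n * 16))%N (n ^ n)%N (n ^ (32 * M ^ 2))%N (n ^ (n * D))%N
      (n ^ 16)%N (n ^ (8 * D * h))%N ((D.+1 ^ 16) ^ (n * D))%N
      (((16 * D) ^ 8) ^ (n * D))%N => a1 a2 a3 a4 a5 a6 a7 a8.
    by ring.
  apply: (leq_trans (leq_mul (leqnn _) b5)); rewrite -expnD leq_pexp2l //.
  clear -small nD h4 D3 n0; nia.
rewrite -(@leq_exp2r _ _ 16) // -(leq_pmul2r X0).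
exact: leq_trans upper lower.
Qed.
(** * Random regular graphs *)

Lemma embeddable_graph_is_decoded (R : realType) n D M
    (G : simple_graph 'I_n) (X : normedVectType R) :
  G \in regular_graphs n D -> (24 ^ \dim {:X} <= M.+1)%N ->
  geometrically_embeds X G ->
  exists c : graph_code 'I_n D M, edges G = decode 'I_n D M c.
Proof.
rewrite inE => /forallP Greg dM [V [f [/bij_inj finj fadj]]].
pose p v : X := val (f v).
have [k [l [s [s_size l_close l_step]]]] := lattice_rounding R X _ p.
apply: (@regular_graph_is_decoded _ _ _ G k l s).
- by move=> v; exact/eqP.
- exact: leq_trans s_size dM.
- move=> v w /l_close pvw vw; rewrite fadj adj_geometric_graph pvw andbT.
  by rewrite inj_eq.
- move=> v w vw; apply: l_step; case/orP: vw => [|/eqP->].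
    by rewrite fadj adj_geometric_graph => /andP[].
  by rewrite subrr normr0.
Qed.

Lemma card_low_dim_graphs (R : realType) (n D M : nat)
    (B : {set simple_graph 'I_n}) : (0 < M)%N ->
  B \subset regular_graphs n D ->
  (forall G, G \in B -> exists X : normedVectType R,
     (24 ^ \dim {:X} <= M)%N /\ geometrically_embeds X G) ->
  (#|B| <= code_bound n M D)%N.
Proof.
case: M => // M _ BA Bemb.
rewrite -(card_imset _ val_inj).
have -> : code_bound n M.+1 D = #|{: graph_code 'I_n D M}|.
  by rewrite card_graph_code card_ord.
rewrite -cardsT; apply: leq_trans (leq_imset_card (decode 'I_n D M) _).
apply: subset_leq_card; apply/fintype.subsetP => _ /imsetP[G GB ->].
have [X [dX Gemb]] := Bemb G GB.
have GA := fintype.subsetP BA _ GB.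
have [c cE] := embeddable_graph_is_decoded R n D M G X GA dX Gemb.
by apply/imsetP; exists c.
Qed.

(** With M the largest power of 24 such that M ^ 16 <= n, a dimension d with
    24 ^ (16 d) <= n allows at most M steps; M does not depend on d, so a single
    family of codes serves all these dimensions. *)
Lemma low_dim_graphs_are_rare (R : realType) D : (3 <= D)%N ->
  exists n0, forall n (B : {set simple_graph 'I_n}), (n0 <= n)%N ->
    ~~ odd (D * n) -> B \subset regular_graphs n D ->
    (forall G, G \in B -> exists X : normedVectType R,
       ((24 ^ 16) ^ \dim {:X} <= n)%N /\ geometrically_embeds X G) ->
    (0 < #|regular_graphs n D|)%N /\ (#|B| * n <= #|regular_graphs n D|)%N.
Proof.
move=> D3; have [n0 n0P] := code_bound_lt_graphs D D3.
exists (n0 + 4 * D)%N => n B nn0 Dn BA Bemb.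
(* The circulant part needs more than D vertices: it gets between 2 D and 4 D. *)
pose h := (n %% (2 * D) + (2 * D).-1)%N.
pose q := (n %/ (2 * D)).-1.
have nE : n = (2 * D * q + h.+1)%N.
  have nq : (0 < n %/ (2 * D))%N by rewrite divn_gt0; lia.
  have -> : h.+1 = (n %% (2 * D) + 2 * D)%N by rewrite /h; lia.
  rewrite addnCA addnC -mulnSr /q prednK // mulnC addnC.
  by rewrite {1}(divn_eq n (2 * D)) addnC.
have lt_mod : (n %% (2 * D) < 2 * D)%N by rewrite ltn_mod; lia.
have Dh : (D < h.+1)%N by rewrite /h; lia.
have odd_h : ~~ odd (D * h.+1).
  by move: Dn; rewrite {1}nE; rewrite !oddM oddD !oddM /=.
have graphs := regular_graphs_lower_bound D q h Dh odd_h.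
rewrite -nE in graphs.
split; first by apply: leq_trans graphs; rewrite expn_gt0 fact_gt0.
(* The numeral is hidden lest it be computed in unary. *)
have [b bE] : exists b, b = (24 ^ 16)%N by eexists.
have b1 : (1 < b)%N by rewrite bE -(exp1n 16) ltn_exp2r.
pose M := (24 ^ trunc_log b n)%N.
have M0 : (0 < M)%N by rewrite expn_gt0.
have Mn : (M ^ 16 <= n)%N.
  by rewrite /M expnAC -bE; apply: trunc_logP => //; lia.
have BM : (#|B| <= code_bound n M D)%N.
  apply: (card_low_dim_graphs R n D M B M0 BA) => G GB.
  have [X [dX Gemb]] := Bemb G GB; exists X; split=> //.
  by rewrite /M leq_pexp2l //; apply: trunc_log_max; rewrite ?bE // -bE.
apply: leq_trans graphs; apply: leq_trans (_ : code_bound n M D * n <= _)%N.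
  by rewrite leq_mul2r BM orbT.
apply: n0P nE _ M0 Mn; first by apply: leq_trans nn0; exact: leq_addr.
by rewrite /h; lia.
Qed.

Theorem theorem1p3 (R : realType) :
  exists c : R, 0 < c /\
    forall D : nat, (3 <= D)%N ->
      uniform_pr R (regular_graphs n D) (fun G : simple_graph 'I_n =>
        forall d : nat, (1 <= d)%N -> d%:R <= c * ln n%:R ->
        forall X : normedVectType R, \dim {:X} = d ->
          ~ geometrically_embeds X G)
        @[n --> within [set n : nat | ~~ odd (D * n)] \oo] --> (1 : R).
Proof.
pose b : R := 24%:R ^+ 16.
have b1 : 1 < b by rewrite /b exprn_egt1 // ltr1n.
have lnb : 0 < ln b by rewrite ln_gt0.
exists (ln b)^-1; split; first by rewrite invr_gt0.
move=> D D3; have [n0 n0P] := low_dim_graphs_are_rare R D D3.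
apply/cvgrPdist_le => e e0.
rewrite near_withinE.
exists (maxn n0 (Num.truncn e^-1).+1) => // n /=; rewrite geq_max => /andP[nn0 ne] Dn.
set P := fun G : simple_graph 'I_n => _.
set A := regular_graphs n D.
pose B := [set G in A | ~~ `[< P G >]]%SET.
have n_gt0 : (0 < n)%N by lia.
have [||A0 BA] := n0P n B nn0 Dn.
- by apply/fintype.subsetP => G; rewrite inE => /andP[].
- move=> G; rewrite inE => /andP[GA /asboolPn].
  move=> /existsNP[d /not_implyP[d1 /not_implyP[dn /existsNP[X]]]].
  move=> /not_implyP[dX /contrapT Gemb]; exists X; split=> //.
  rewrite dX -(ler_nat R) !natrX -/b.
  have b0 : 0 < b by exact: lt_trans b1.
  rewrite -ler_ln ?posrE ?ltr0n ?exprn_gt0 // lnXn // -[ln b *+ d]mulr_natl.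
  by move: dn; rewrite mulrC ler_pdivlMr.
have cardA : #|A| = (#|[set G in A | `[< P G >]]%SET| + #|B|)%N.
  rewrite -(cardsID [set G | `[< P G >]]%SET A); congr addn; apply: eq_card => G.
    by rewrite !inE.
  by rewrite !inE andbC.
have A0' : 0 < #|A|%:R :> R by rewrite ltr0n.
have -> : 1 - uniform_pr R A P = #|B|%:R / #|A|%:R.
  rewrite /uniform_pr -{1}(divff (lt0r_neq0 A0')) -mulrBl.
  by rewrite {1}cardA natrD addrC addKr.
rewrite ger0_norm ?divr_ge0 // ler_pdivrMr //.
have ne' : e^-1 <= n%:R.
  by apply: ltW; apply: lt_le_trans (truncnS_gt _) _; rewrite ler_nat.
apply: (@le_trans _ _ (e * (#|B| * n)%:R)); last by rewrite ler_pM2l // ler_nat.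
rewrite natrM mulrCA ler_peMr //.
by rewrite -ler_pdivrMl // mulr1.
Qed.
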